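(* Let $D$ be an oriented graph. Then $D$ is switching-stable (i.e. for every vertex $v$ of $D$, the digraph $D_v$ is isomorphic to $D$) if and only if each (weakly) connected component of $D$ is isomorphic to one of the following three oriented graphs: the oriented graph with a single vertex and no edges; the oriented graph with two vertices and a single edge; the oriented 4-cycle that has a unique directed path of length 3, i.e. the oriented graph on vertices $v_1,v_2,v_3,v_4$ with exactly the edges $v_1\to v_2$, $v_2\to v_3$, $v_3\to v_4$, $v_1\to v_4$.
   Context: All graphs are finite. An oriented graph is a digraph without loops, parallel edges, or directed 2-cycles. For a digraph $D$ and a vertex $v$, the switching $D_v$ of $D$ at $v$ is the digraph equal to $D$ except that the direction of every edge incident with $v$ is reversed. Components are the connected components of the underlying undirected graph, with the induced orientations. *)

(* Defs.v *)
From mathcomp Require Import all_boot.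

Set Implicit Arguments.
Unset Strict Implicit.
Unset Printing Implicit Defensive.

(* A finite digraph without parallel edges is a boolean relation e on a       *)
(* finType of vertices, e x y meaning that x -> y is an edge.                 *)

Definition oriented (T : finType) (e : rel T) : Prop :=
  irreflexive e /\ (forall x y : T, ~~ (e x y && e y x)).

Definition switch (T : finType) (e : rel T) (v : T) : rel T :=
  fun x y => if (x == v) || (y == v) then e y x else e x y.

Definition digraph_iso (T U : finType) (e : rel T) (f : rel U) : Prop :=
  exists2 h : T -> U, bijective h & forall x y : T, f (h x) (h y) = e x y.

Definition switching_stable (T : finType) (e : rel T) : Prop :=
  forall v : T, digraph_iso (switch e v) e.

Definition underlying (T : finType) (e : rel T) : rel T :=
  fun x y => e x y || e y x.

Definition components (T : finType) (e : rel T) : {set {set T}} :=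
  [set [set y | connect (underlying e) x y] | x in T].

Definition induced (T : finType) (e : rel T) (C : {set T}) :
    rel {x : T | x \in C} :=
  fun x y => e (val x) (val y).
Arguments induced {T} e C.

Definition single_vertex : rel 'I_1 := fun _ _ => false.

Definition single_edge : rel 'I_2 :=
  fun i j => (val i, val j) == (0, 1).

(* The vertices v_1, ..., v_4 are numbered 0, ..., 3. *)
Definition oriented_C4 : rel 'I_4 :=
  fun i j => (val i, val j) \in [:: (0, 1); (1, 2); (2, 3); (0, 3)].

(* Main.v *)
(* Comparing a digraph with its switching at v, the number of vertices of     *)
(* total degree k and out-degree larger than i is unchanged. This yields a    *)
(* local identity at v between its out-neighbours of out-degree i and its     *)
(* in-neighbours of out-degree i + 1. Applied along an edge into a vertex of  *)
(* maximal out-degree, it shows that every component contains a source x.     *)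
(* If x has out-degree k >= 2, the identity provides a path x -> w -> z with  *)
(* w and z of in-degree 1 and degree k. Switching at w makes z a source,      *)
(* hence z has a sink child of in-degree k, which was already there before    *)
(* switching; the identity at z then forces k = 2. Switching at x makes w a   *)
(* source, and the same path found from w shows that the child of z is the    *)
(* sink child of x, which closes the 4-cycle.                                 *)

Require Import Defs.
From mathcomp Require Import all_boot zify.

Set Implicit Arguments.
Unset Strict Implicit.
Unset Printing Implicit Defensive.

(** An isomorphism from [switch e v] to [e] preserves all degree counts, while switching at [v]
    keeps total degrees and alters out-degrees only at [v] and its neighbours. Comparing counts
    gives [threshold], from which every degree fact about stable digraphs is drawn.
    [connected_to_source] puts a source in each component and [source_deg_le2] bounds its out-degree
    by 2; the vertices then found by [source_to_sink] or [source_outdeg2] have all their edges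
    accounted for, so they fill the component. Conversely, explicit maps show the three small graphs
    stable, and [stable_of_components] glues. *)

(** * Isomorphisms and switchings *)

Lemma digraph_iso_sym (T U : finType) (e : rel T) (f : rel U) :
  digraph_iso e f -> digraph_iso f e.
Proof.
case=> h [g hK gK] hE; exists g; first by exists h.
by move=> x y; rewrite -hE !gK.
Qed.

Lemma digraph_iso_trans (T U V : finType) (e : rel T) (f : rel U) (g : rel V) :
  digraph_iso e f -> digraph_iso f g -> digraph_iso e g.
Proof.
case=> h bh hE [h' bh' hE']; exists (h' \o h); first exact: bij_comp.
by move=> x y /=; rewrite hE' hE.
Qed.

Lemma digraph_iso_switch (T U : finType) (e : rel T) (f : rel U) (h : T -> U) v :
    bijective h -> (forall x y, f (h x) (h y) = e x y) ->
  digraph_iso (switch e v) (switch f (h v)).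
Proof.
move=> bh hE; exists h => // x y; rewrite /switch !hE.
by rewrite !(inj_eq (bij_inj bh)).
Qed.

Lemma stable_iso (T U : finType) (e : rel T) (f : rel U) :
  digraph_iso e f -> switching_stable f -> switching_stable e.
Proof.
move=> ef sf v; have [h bh hE] := ef.
apply: digraph_iso_trans (digraph_iso_switch v bh hE) _.
exact: digraph_iso_trans (sf _) (digraph_iso_sym ef).
Qed.

Lemma oriented_switch (T : finType) (e : rel T) v :
  oriented e -> oriented (switch e v).
Proof.
case=> ir as_; split=> [x | x y]; rewrite /switch; first by rewrite !ir if_same.
by rewrite (orbC (y == v)); case: ifP; rewrite // andbC.
Qed.

Lemma switch_neq (T : finType) (e : rel T) v x y :
  x != v -> y != v -> switch e v x y = e x y.
Proof. by rewrite /switch => /negPf-> /negPf->. Qed.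

Lemma switch_l (T : finType) (e : rel T) v y : switch e v v y = e y v.
Proof. by rewrite /switch eqxx. Qed.

Lemma switch_r (T : finType) (e : rel T) v y : switch e v y v = e v y.
Proof. by rewrite /switch eqxx orbT. Qed.

Lemma digraph_iso_induced (T U : finType) (e : rel T) (f : rel U)
    (C : {set T}) (g : U -> T) :
    injective g -> (forall i j, e (g i) (g j) = f i j) ->
    (forall x, (x \in C) = (x \in codom g)) ->
  digraph_iso (induced e C) f.
Proof.
move=> gI gE CE; apply: digraph_iso_sym.
have gC i : g i \in C by rewrite CE codom_f.
exists (fun i => exist _ (g i) (gC i)); last by move=> i j; rewrite /induced gE.
apply: inj_card_bij => [i j [] /gI // |].
by rewrite card_sig (eq_card CE) card_codom.
Qed.

(** * Degrees and their change under switching *)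

Section Degrees.

Variables (T : finType) (e : rel T).

Definition outdeg x := \sum_y e x y.
Definition indeg x := \sum_y e y x.
Definition deg x := outdeg x + indeg x.

Lemma outdeg_gt0 x y : e x y -> 0 < outdeg x.
Proof. by move=> xy; rewrite /outdeg (bigD1 y) //= xy. Qed.

Lemma indeg_gt0 x y : e y x -> 0 < indeg x.
Proof. by move=> yx; rewrite /indeg (bigD1 y) //= yx. Qed.

Lemma outdeg0 x y : outdeg x = 0 -> e x y = false.
Proof. by move=> x0; apply/negP => /outdeg_gt0; rewrite x0. Qed.

Lemma indeg0 x y : indeg x = 0 -> e y x = false.
Proof. by move=> x0; apply/negP => /indeg_gt0; rewrite x0. Qed.

Lemma outdeg1 x y z : outdeg x = 1 -> e x y -> e x z = (z == y).
Proof.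
move=> x1 xy; case: eqVneq => [-> // | zy]; apply/negP => xz.
move: x1; rewrite /outdeg (bigD1 y) //= (bigD1 z) //= xy xz; lia.
Qed.

Lemma indeg1 x y z : indeg x = 1 -> e y x -> e z x = (z == y).
Proof.
move=> x1 yx; case: eqVneq => [-> // | zy]; apply/negP => zx.
move: x1; rewrite /indeg (bigD1 y) //= (bigD1 z) //= yx zx; lia.
Qed.

Lemma outdeg2 x y1 y2 z :
  outdeg x = 2 -> y1 != y2 -> e x y1 -> e x y2 -> e x z = (z == y1) || (z == y2).
Proof.
move=> x2 y12 xy1 xy2; case: eqVneq => [-> // | zy1].
case: eqVneq => [-> // | zy2]; apply/negP => xz.
move: x2; rewrite /outdeg (bigD1 y1) //= (bigD1 y2) 1?eq_sym //=.
by rewrite (bigD1 z) /= ?zy1 // xy1 xy2 xz; lia.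
Qed.

Lemma indeg2 x y1 y2 z :
  indeg x = 2 -> y1 != y2 -> e y1 x -> e y2 x -> e z x = (z == y1) || (z == y2).
Proof.
move=> x2 y12 xy1 xy2; case: eqVneq => [-> // | zy1].
case: eqVneq => [-> // | zy2]; apply/negP => xz.
move: x2; rewrite /indeg (bigD1 y1) //= (bigD1 y2) 1?eq_sym //=.
by rewrite (bigD1 z) /= ?zy1 // xy1 xy2 xz; lia.
Qed.

End Degrees.

Section SwitchDegrees.

Variables (T : finType) (e : rel T) (v : T).

Lemma outdeg_switch_eq : outdeg (switch e v) v = indeg e v.
Proof. by apply: eq_bigr => y _; rewrite switch_l. Qed.

Lemma indeg_switch_eq : indeg (switch e v) v = outdeg e v.
Proof. by apply: eq_bigr => y _; rewrite switch_r. Qed.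

Lemma outdeg_switch u :
  u != v -> outdeg (switch e v) u + e u v = outdeg e u + e v u.
Proof.
move=> uv; rewrite /outdeg (bigD1 v) //= [in RHS](bigD1 v) //= switch_r.
rewrite (eq_bigr (fun y => e u y : nat)) => [|y yv]; first lia.
by rewrite switch_neq.
Qed.

Lemma indeg_switch u :
  u != v -> indeg (switch e v) u + e v u = indeg e u + e u v.
Proof.
move=> uv; rewrite /indeg (bigD1 v) //= [in RHS](bigD1 v) //= switch_l.
rewrite (eq_bigr (fun y => e y u : nat)) => [|y yv]; first lia.
by rewrite switch_neq.
Qed.

Lemma switch_child u : oriented e -> e v u ->
  outdeg (switch e v) u = (outdeg e u).+1 /\ indeg (switch e v) u = (indeg e u).-1.
Proof.
case=> ir as_ vu; have uv : u != v by apply: contraTneq vu => ->; rewrite ir.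
have euv : e u v = false by have := as_ u v; rewrite vu andbT => /negPf.
have := outdeg_switch uv; have := indeg_switch uv; rewrite vu euv; lia.
Qed.

Lemma switch_nonadjacent u : u != v -> e u v = false -> e v u = false ->
  outdeg (switch e v) u = outdeg e u /\ indeg (switch e v) u = indeg e u.
Proof.
move=> uv euv vu.
have := outdeg_switch uv; have := indeg_switch uv; rewrite vu euv; lia.
Qed.

Lemma deg_switch u : deg (switch e v) u = deg e u.
Proof.
rewrite /deg; have [->|uv] := eqVneq u v.
  by rewrite outdeg_switch_eq indeg_switch_eq addnC.
have := outdeg_switch uv; have := indeg_switch uv; lia.
Qed.

End SwitchDegrees.

Lemma outdeg_iso (T U : finType) (e : rel T) (f : rel U) (h : T -> U) x :
    bijective h -> (forall x y, f (h x) (h y) = e x y) ->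
  outdeg f (h x) = outdeg e x.
Proof.
move=> bh hE; rewrite /outdeg (reindex h) /=; last exact: onW_bij.
by apply: eq_bigr => y _; rewrite hE.
Qed.

Lemma indeg_iso (T U : finType) (e : rel T) (f : rel U) (h : T -> U) x :
    bijective h -> (forall x y, f (h x) (h y) = e x y) ->
  indeg f (h x) = indeg e x.
Proof.
move=> bh hE; rewrite /indeg (reindex h) /=; last exact: onW_bij.
by apply: eq_bigr => y _; rewrite hE.
Qed.

(** * The local degree identity and its consequences *)

Section Threshold.

Variables (T : finType) (e : rel T).
Hypotheses (He : oriented e) (Se : switching_stable e).

(** Count the vertices of degree [k] with out-degree above [i] before and after switching at [v]. A
    child of [v] gains an out-edge, entering the count if its out-degree was [i]; a parent loses
    one, leaving it if its out-degree was [i.+1]; [v] swaps its two degrees. *)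
Lemma threshold v k i :
  \sum_u [&& e v u, deg e u == k & outdeg e u == i]
    + ((deg e v == k) && (i < indeg e v)) =
  \sum_u [&& e u v, deg e u == k & outdeg e u == i.+1]
    + ((deg e v == k) && (i < outdeg e v)).
Proof.
have [ir as_] := He; have [h bh hE] := Se v.
pose N (f : rel T) := \sum_u ((deg f u == k) && (i < outdeg f u)).
have Neq : N (switch e v) = N e.
  rewrite /N [RHS](reindex h) /=; last exact: onW_bij.
  apply: eq_bigr => u _; rewrite /deg.
  by rewrite (outdeg_iso _ bh hE) (indeg_iso _ bh hE).
move: Neq; rewrite /N (bigD1 v) //= [in RHS](bigD1 v) //=.
rewrite deg_switch outdeg_switch_eq.
rewrite [X in _ -> X + _ = _](bigD1 v) //= [X in _ -> _ = X + _](bigD1 v) //=.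
rewrite !ir /= !add0n => Neq.
(* Gains and losses away from [v], vertex by vertex, written without subtraction. *)
have : \sum_(u | u != v) ((deg (switch e v) u == k) && (i < outdeg (switch e v) u))
       + \sum_(u | u != v) [&& e u v, deg e u == k & outdeg e u == i.+1]
     = \sum_(u | u != v) ((deg e u == k) && (i < outdeg e u))
       + \sum_(u | u != v) [&& e v u, deg e u == k & outdeg e u == i].
  rewrite -!big_split; apply: eq_bigr => u uv /=; rewrite deg_switch.
  have := outdeg_switch e uv; have := as_ u v.
  by case: (deg e u == k); case: (e u v); case: (e v u) => //= _; lia.
lia.
Qed.

Lemma sum_bool_gt0 (P : pred T) : reflect (exists u, P u) (0 < \sum_u P u).
Proof.
rewrite lt0n sum_nat_eq0 negb_forall; apply: (iffP existsP) => -[u Pu]; exists u.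
  by move: Pu; case: (P u).
by rewrite Pu.
Qed.

(** The vertex [u] makes the left side of [threshold] positive; one of the two terms on the right
    must balance it. *)
Lemma child_gives_parent v u : e v u ->
  (exists2 t, e t v & deg e t = deg e u /\ outdeg e t = (outdeg e u).+1)
  \/ deg e v = deg e u /\ indeg e v <= outdeg e u < outdeg e v.
Proof.
move=> vu; have := threshold v (deg e u) (outdeg e u).
set p := \sum_w _; set q := \sum_w _.
have : 0 < p by apply/sum_bool_gt0; exists u; rewrite vu !eqxx.
have [q0 | /sum_bool_gt0[t /and3P[tv /eqP td /eqP to]]] := posnP q.
  by rewrite q0; case: eqP => [vd|_] /= *; right; lia.
by left; exists t.
Qed.

(** [threshold] read backwards: a parent, or [v] itself, makes the right side positive, and the side
    conditions keep the [v] term on the left from absorbing it. *)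
Lemma child_exists v k i :
    (exists2 t, e t v & deg e t = k /\ outdeg e t = i.+1)
      /\ (deg e v = k -> i < indeg e v -> i < outdeg e v)
    \/ deg e v = k /\ indeg e v <= i < outdeg e v ->
  exists2 u, e v u & deg e u = k /\ outdeg e u = i.
Proof.
move=> H; suff /sum_bool_gt0[u /and3P[vu /eqP ? /eqP ?]]:
  0 < \sum_w [&& e v w, deg e w == k & outdeg e w == i] by exists u.
have := threshold v k i; case: H => [[[t tv [tk ti]] H] | [-> /andP[vi iv]]].
  have : 0 < \sum_w [&& e w v, deg e w == k & outdeg e w == i.+1].
    by apply/sum_bool_gt0; exists t; rewrite tv tk ti !eqxx.
  by case: eqP => [/H{}H|_] //=; lia.
rewrite eqxx /=; lia.
Qed.

(** A vertex of maximal out-degree in the component is a source: given a parent of it, both outcomes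
    of [child_gives_parent] yield a larger out-degree. *)
Lemma connected_to_source x :
  exists2 y, connect (underlying e) x y & indeg e y = 0.
Proof.
pose bad := [pred u | connect (underlying e) x u].
case: (@arg_maxnP _ x bad (outdeg e)) => [|u xu umax]; first exact: connect0.
exists u => //; apply/eqP; rewrite -leqn0 leqNgt; apply/negP => /sum_bool_gt0[v vu].
have xv : bad v.
  by apply: connect_trans xu (connect1 _); rewrite /underlying vu orbT.
have [[t tv [_ tu]] | [_ /andP[_]]] := child_gives_parent vu.
  have : bad t.
    by apply: connect_trans xv (connect1 _); rewrite /underlying tv orbT.
  by move/umax; rewrite /= tu; lia.
by have := umax _ xv; rewrite /=; lia.
Qed.

(** At a source, the second case of [child_exists] applies for every [i] below the out-degree: 0
    here, the largest such [i] in [source_to_indeg1]. *)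
Lemma source_to_sink x : indeg e x = 0 -> 0 < outdeg e x ->
  exists y, [/\ e x y, outdeg e y = 0 & indeg e y = outdeg e x].
Proof.
move=> x0 xk; have [|y xy [yd y0]] := @child_exists x (outdeg e x) 0.
  by right; rewrite /deg; lia.
by exists y; split=> //; move: yd; rewrite /deg y0.
Qed.

Lemma source_to_indeg1 x : indeg e x = 0 -> 0 < outdeg e x ->
  exists w, [/\ e x w, outdeg e w = (outdeg e x).-1 & indeg e w = 1].
Proof.
move=> x0 xk; have [|y xy [yd y0]] := @child_exists x (outdeg e x) (outdeg e x).-1.
  by right; rewrite /deg; lia.
by exists y; split=> //; move: yd; rewrite /deg y0; lia.
Qed.

(** The first case of [child_exists] applies at [w] with parent [x]; its side condition is vacuous
    because [indeg e w] does not exceed [(outdeg e x).-1]. *)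
Lemma source_to_indeg1_indeg1 x w :
    indeg e x = 0 -> 1 < outdeg e x -> e x w ->
    outdeg e w = (outdeg e x).-1 -> indeg e w = 1 ->
  exists z, [/\ e w z, outdeg e z = (outdeg e x).-1 & indeg e z = 1].
Proof.
move=> x0 xk xw wo wi.
have [|z wz [zd zo]] := @child_exists w (outdeg e x) (outdeg e x).-1.
  by left; split; [exists x => // | ]; rewrite /deg; lia.
by exists z; split=> //; move: zd; rewrite /deg zo; lia.
Qed.

End Threshold.

(** * The component of a source *)

Lemma source_deg_le2 (T : finType) (e : rel T) x :
  oriented e -> switching_stable e -> indeg e x = 0 -> outdeg e x <= 2.
Proof.
move=> He Se x0; rewrite leqNgt; apply/negP => x3.
have [ir as_] := He.
have [|w [xw wo wi]] := source_to_indeg1 He Se x0; first lia.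
have [|z [wz zo zi]] := source_to_indeg1_indeg1 He Se x0 _ xw wo wi; first lia.
have zw : z != w by apply: contraTneq wz => ->; rewrite ir.
have zx : e z x = false by exact: indeg0.
have Hw := oriented_switch w He.
have Sw : switching_stable (switch e w) by exact: stable_iso (Se w) Se.
(* Losing its only parent [w], [z] becomes a source with the out-degree of [x]. *)
have [z'k z'0] := switch_child He wz; rewrite zi /= in z'0.
rewrite zo prednK ?(ltn_trans _ x3) // in z'k.
have [|y [zy y0 yk]] := source_to_sink Hw Sw z'0; first by rewrite z'k (ltn_trans _ x3).
rewrite z'k in yk.
have yw : y != w.
  by apply/eqP => yw; move: y0; rewrite yw outdeg_switch_eq wi.
have {}zy : e z y by move: zy; rewrite switch_neq.
have wy : e w y = false.
  by have := outdeg0 w y0; rewrite switch_r.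
have yw' : e y w = false.
  by rewrite (indeg1 _ wi xw); apply/eqP => yx; rewrite yx zx in zy.
have [yo yi] := switch_nonadjacent yw yw' wy.
rewrite {}yo in y0; rewrite {}yi in yk.
(* The sink [y] forces a parent of [z] with out-degree 1, but the only parent [w] has out-degree at
   least 2. *)
have [[t tz [_ t1]] | [_]] := child_gives_parent He Se zy; last first.
  by rewrite zi y0.
move: tz t1; rewrite (indeg1 _ zi wz) => /eqP->; rewrite wo y0 => k1.
by case: (outdeg e x) x3 k1 => [|[|[]]].
Qed.

Lemma source_outdeg2 (T : finType) (e : rel T) x :
    oriented e -> switching_stable e -> indeg e x = 0 -> outdeg e x = 2 ->
  exists w z y, [/\ [/\ e x w, e w z, e z y & e x y],
    [/\ outdeg e w = 1, outdeg e z = 1 & outdeg e y = 0]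
    & [/\ indeg e w = 1, indeg e z = 1 & indeg e y = 2]].
Proof.
move=> He Se x0 x2; have [ir as_] := He.
have [|w [xw wo wi]] := source_to_indeg1 He Se x0; first lia.
have [|z [wz zo zi]] := source_to_indeg1_indeg1 He Se x0 _ xw wo wi; first lia.
rewrite x2 /= in wo zo.
have [|y [xy yo yi]] := source_to_sink He Se x0; first lia.
rewrite x2 in yi.
have [|t zt [td to]] := @child_exists _ _ He Se z 2 0.
  by left; split; [exists w => //; rewrite /deg; lia | lia].
exists w, z, y; split=> //; split=> //.
(* If the sink [t] were not [y], it would not be adjacent to [x] and would stay a sink after
   switching there. *)
have [<- // | ty] := eqVneq t y.
have wy : w != y by apply/eqP => wy; rewrite wy yo in wo.
have tw : t != w by apply/eqP => tw; rewrite tw wo in to.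
have tx : t != x by apply/eqP => tx; rewrite tx x2 in to.
have zx : z != x by apply: contraTneq wz => ->; rewrite indeg0.
have wx : w != x by apply: contraTneq xw => ->; rewrite ir.
have exz : e x z = false.
  by rewrite (indeg1 _ zi wz) eq_sym (negPf wx).
have ext : e x t = false by rewrite (outdeg2 _ x2 wy xw xy) (negPf tw) (negPf ty).
have etx u : e u x = false by exact: indeg0.
have Hx := oriented_switch x He.
have Sx : switching_stable (switch e x) by exact: stable_iso (Se x) Se.
have [w'2 w'0] := switch_child He xw; rewrite wo in w'2; rewrite wi in w'0.
have wz' : switch e x w z by rewrite switch_neq.
have [z'o z'i] := switch_nonadjacent zx (etx z) exz; rewrite zo in z'o; rewrite zi in z'i.
(* From the new source [w], the vertex [z] must have a child of out-degree 1, yet its only child is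
   the sink [t]. *)
have [|||u [zu uo ui]] := source_to_indeg1_indeg1 Hx Sx w'0 _ wz'; rewrite ?w'2 //.
have zt' : switch e x z t by rewrite switch_neq.
move: zu; rewrite (outdeg1 _ z'o zt') => /eqP ut.
by move: uo; rewrite ut w'2 (proj1 (switch_nonadjacent tx (etx t) ext)) to.
Qed.

(** A path from [x] cannot leave a set closed under adjacency, so the tuple lists the whole
    component, numbered as in [f]. *)
Lemma component_iso (T : finType) (e : rel T) n (t : n.-tuple T)
    (f : rel 'I_n) x :
    uniq t -> x \in t -> all (connect (underlying e) x) t ->
    (forall y z, y \in t -> underlying e y z -> z \in t) ->
    (forall i j, e (tnth t i) (tnth t j) = f i j) ->
  digraph_iso (induced e [set z | connect (underlying e) x z]) f.
Proof.
move=> /tuple_uniqP tI xt /allP xall tcl tE.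
apply: (digraph_iso_induced tI) => // y.
rewrite inE /codom /image_mem map_tnth_enum.
apply/idP/idP => [/connectP[p]|/xall //].
elim: p x {xall} xt => [|z p IHp] x xt /=; first by move=> _ ->.
by case/andP=> xz pz; apply: (IHp z) => //; apply: tcl xz.
Qed.

Lemma source_component (T : finType) (e : rel T) x :
    oriented e -> switching_stable e -> indeg e x = 0 ->
  let C := [set y | connect (underlying e) x y] in
  [\/ digraph_iso (induced e C) single_vertex,
      digraph_iso (induced e C) single_edge
    | digraph_iso (induced e C) oriented_C4].
Proof.
move=> He Se x0 C; have [ir as_] := He.
have ex u : e u x = false by exact: indeg0.
have := source_deg_le2 He Se x0; case xk: (outdeg e x) => [|[|[|]]] // _.
- constructor 1; apply: (@component_iso _ _ _ [tuple x]) => //=.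
  + exact: mem_head.
  + by rewrite connect0.
  + by move=> y z; rewrite inE => /eqP->; rewrite /underlying ex (outdeg0 _ xk).
  by move=> i j; rewrite !ord1 /tnth /= ir.
- constructor 2; have [|w [xw wo wi]] := source_to_sink He Se x0; first by rewrite xk.
  rewrite xk in wi.
  have exE z : e x z = (z == w) := outdeg1 z xk xw.
  have wx : x != w by apply: contraTneq xw => <-; rewrite ir.
  apply: (@component_iso _ _ _ [tuple x; w]) => //=.
  + by rewrite inE wx.
  + exact: mem_head.
  + by rewrite connect0 connect1 // /underlying xw.
  + move=> y z; rewrite !inE => /orP[] /eqP->; rewrite /underlying.
      by rewrite ex orbF exE => ->; rewrite orbT.
    by rewrite (outdeg0 _ wo) (indeg1 z wi xw) /= => ->.
  have ewE u : e w u = false := outdeg0 u wo.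
  by case=> [[|[|[]]] ? ] // [[|[|[]]] ? ].
constructor 3; have [w [z [y [[xw wz zy xy] [wo zo yo] [wi zi yi]]]]] :=
  source_outdeg2 He Se x0 xk.
have neq a b : e a b -> a != b by apply: contraTneq => ->; rewrite ir.
have wy : w != y by apply/eqP => wy; rewrite wy yo in wo.
have xz : x != z by apply/eqP => xz; rewrite xz zo in xk.
have exE u : e x u = (u == w) || (u == y) := outdeg2 u xk wy xw xy.
have ewE u : e w u = (u == z) := outdeg1 u wo wz.
have ezE u : e z u = (u == y) := outdeg1 u zo zy.
have eyE u : e y u = false := outdeg0 u yo.
apply: (@component_iso _ _ _ [tuple x; w; z; y]) => //=.
- by rewrite !inE !negb_or xz wy !neq.
- exact: mem_head.
- have xw' : connect (underlying e) x w by rewrite connect1 // /underlying xw.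
  rewrite connect0 xw' (@connect1 _ _ x y) /underlying ?xy // !andbT.
  by apply: connect_trans xw' (connect1 _); rewrite /underlying wz.
- move=> a b; rewrite !inE /underlying => /or4P[] /eqP->.
  + by rewrite ex orbF exE => /orP[] ->; rewrite ?orbT.
  + by rewrite ewE (indeg1 b wi xw) => /orP[] ->; rewrite ?orbT.
  + by rewrite ezE (indeg1 b zi wz) => /orP[] ->; rewrite ?orbT.
  by rewrite eyE orFb (indeg2 b yi xz xy zy) => /orP[] ->; rewrite ?orbT.
have [nxw nwz nzy nxy] : [/\ x != w, w != z, z != y & x != y].
  by rewrite !neq.
have nE := (negPf nxw, negPf nwz, negPf nzy, negPf nxy, negPf wy, negPf xz).
case=> [[|[|[|[|]]]] ? ] // [[|[|[|[|]]]] ? ] //; rewrite /tnth /=;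
  by rewrite ?exE ?ewE ?ezE ?eyE ?eqxx ?nE // eq_sym nE // eq_sym nE.
Qed.

(** * Stability from the components, and the three small graphs *)

Lemma stable_of_components (T : finType) (e : rel T) :
    (forall C, C \in components e -> switching_stable (induced e C)) ->
  switching_stable e.
Proof.
move=> Hc v; pose C := [set y | connect (underlying e) v y].
have vC : v \in C by rewrite inE connect0.
have /Hc/(_ (exist _ v vC)) [h bh hE] : C \in components e by exact: imset_f.
have Ccl x y : underlying e x y -> (x \in C) = (y \in C).
  rewrite !inE => xy; apply/idP/idP => /connect_trans; apply; apply: connect1 => //.
  by rewrite /underlying orbC.
have Ccl' x y : x \in C -> y \notin C -> e x y = false /\ e y x = false.
  move=> xC yC; split; apply/negP => xy; case/negP: yC.
    by rewrite -(Ccl x) // /underlying xy.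
  by rewrite (Ccl y x) // /underlying xy.
(* [h] on the component of [v], identity elsewhere: switching at [v] changes no edge outside that
   component. *)
pose H x := if insub x is Some u then val (h u) else x.
have Hin (u : {x | x \in C}) : H (val u) = val (h u) by rewrite /H valK.
have Hout x : x \notin C -> H x = x by move=> xC; rewrite /H insubN.
have HC x : (H x \in C) = (x \in C).
  by rewrite /H; case: insubP => [u -> _|//]; exact: valP.
exists H => [|x y].
  apply: injF_bij => x y Hxy.
  have xyC : (x \in C) = (y \in C) by rewrite -HC Hxy HC.
  have [xC|xC] := boolP (x \in C); last first.
    by rewrite -(Hout _ xC) Hxy Hout // -xyC.
  have yC : y \in C by rewrite -xyC.
  move: Hxy; rewrite -[x]/(val (exist (fun x => x \in C) x xC)).
  rewrite -[y]/(val (exist (fun x => x \in C) y yC)) !Hin.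
  by move/val_inj/(bij_inj bh) => ->.
have nv a : a \notin C -> (a == v) = false.
  by move=> aC; apply: contraNF aC => /eqP->.
have [xC|xC] := boolP (x \in C); have [yC|yC] := boolP (y \in C).
- have := hE (exist _ x xC) (exist _ y yC).
  by rewrite /induced -!Hin /= => ->; rewrite /switch -!val_eqE.
- have [] := Ccl' (H x) y; rewrite ?HC // (Hout _ yC) => -> _.
  by have [xy yx] := Ccl' x y xC yC; rewrite /switch xy yx if_same.
- have [] := Ccl' (H y) x; rewrite ?HC // (Hout _ xC) => _ ->.
  by have [xy yx] := Ccl' y x yC xC; rewrite /switch xy yx if_same.
by rewrite !Hout // /switch !nv.
Qed.

Lemma single_vertex_stable : switching_stable single_vertex.
Proof.
by move=> v; exists id => [|x y]; [exists id | rewrite /switch if_same].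
Qed.

Lemma single_edge_stable : switching_stable single_edge.
Proof.
move=> v; exists (@rev_ord 2) => [|x y]; first by exists (@rev_ord 2); exact: rev_ordK.
by case: v x y => [[|[|[]]] ? ] // [[|[|[]]] ? ] // [[|[|[]]] ? ].
Qed.

Lemma oriented_C4_stable : switching_stable oriented_C4.
Proof.
move=> v.
(* In row [v], entry [i] is the position of [i] along the directed path of length 3 in the switching
   at [v]. *)
pose t := nth [::] [:: [:: 3; 0; 1; 2]; [:: 2; 1; 0; 3]; [:: 0; 3; 2; 1]; [:: 1; 2; 3; 0]] v.
have tlt (i : 'I_4) : nth 0 t i < 4.
  by rewrite /t; case: v i {t} => [[|[|[|[|]]]] ? ] // [[|[|[|[|]]]] ? ].
exists (fun i => Ordinal (tlt i)) => [|x y].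
  apply: injF_bij => x y /(congr1 val) /= xy; apply/val_inj; move: xy.
  by rewrite /t; case: v x y {t tlt} => [[|[|[|[|]]]] ? ] // [[|[|[|[|]]]] ? ] // [[|[|[|[|]]]] ? ].
rewrite /oriented_C4 /switch /=.
by rewrite /t; case: v x y {t tlt} => [[|[|[|[|]]]] ? ] // [[|[|[|[|]]]] ? ] // [[|[|[|[|]]]] ? ].
Qed.

Theorem theorem1 (T : finType) (e : rel T) (He : oriented e) :
  switching_stable e <->
  (forall C : {set T}, C \in components e ->
     [\/ digraph_iso (induced e C) single_vertex,
         digraph_iso (induced e C) single_edge
       | digraph_iso (induced e C) oriented_C4]).
Proof.
split=> [Se C /imsetP[x _ ->] | Hc]; last first.
  apply: stable_of_components => C /Hc[] Ciso; apply: stable_iso Ciso _.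
  - exact: single_vertex_stable.
  - exact: single_edge_stable.
  exact: oriented_C4_stable.
have [s xs s0] := connected_to_source He Se x.
have symu : connect_sym (underlying e).
  by apply: sym_connect_sym => a b; rewrite /underlying orbC.
have -> : [set y | connect (underlying e) x y] = [set y | connect (underlying e) s y].
  by apply/setP => y; rewrite !inE (same_connect symu xs).
exact: source_component.
Qed.
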